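(* Let $n\ge 2$, $m\ge 0$ be integers and let $f=(f_{i_1\dots i_m})\in\mathcal S(\mathbb R^n;S^m\mathbb R^n)$. Then for all indices $(i_1,\dots,i_m)\in\{1,\dots,n\}^m$ the equality $$ Jf_{i_1\dots i_m}=\frac{1}{m!}\,\sigma(i_1\dots i_m)\sum_{k=0}^m(-1)^k\binom{m}{k}\frac{\partial^m(J^kf)}{\partial x^{i_1}\dots\partial x^{i_k}\,\partial\xi^{i_{k+1}}\dots\partial\xi^{i_m}} $$ holds on $\mathbb R^n\times(\mathbb R^n\setminus\{0\})$, where the left-hand side is the result of applying the ray transform $J=J^0$ to the Cartesian coordinate $f_{i_1\dots i_m}$ considered as a scalar function (rank $0$ tensor field) on $\mathbb R^n$.
   Context: $S^m\mathbb R^n$ is the complex vector space of rank $m$ symmetric tensors on $\mathbb R^n$ (so $S^0\mathbb R^n=\mathbb C$, $S^1\mathbb R^n=\mathbb C^n$), and $\mathcal S(\mathbb R^n;S^m\mathbb R^n)$ is the Schwartz space of $S^m\mathbb R^n$-valued functions. Cartesian coordinates are used throughout; upper and lower indices are not distinguished ($\xi^i=\xi_i$). For $f\in\mathcal S(\mathbb R^n;S^m\mathbb R^n)$ and $k=0,1,2,\dots$, the momentum ray transform $J^kf\in C^\infty(\mathbb R^n\times(\mathbb R^n\setminus\{0\}))$ is $$ (J^kf)(x,\xi)=\int_{-\infty}^\infty t^k\langle f(x+t\xi),\xi^m\rangle\,dt,\qquad \langle f(z),\xi^m\rangle=\sum_{i_1,\dots,i_m=1}^n f_{i_1\dots i_m}(z)\,\xi^{i_1}\cdots\xi^{i_m}.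 $$ In particular, for a scalar function $g\in\mathcal S(\mathbb R^n)$, $(Jg)(x,\xi)=(J^0g)(x,\xi)=\int_{-\infty}^\infty g(x+t\xi)\,dt$. The symmetrization is $\sigma(i_1\dots i_m)u_{i_1\dots i_m}=\frac1{m!}\sum_{\pi}u_{i_{\pi(1)}\dots i_{\pi(m)}}$, the sum being over all permutations $\pi$ of $\{1,\dots,m\}$. *)

(* Defs.v *)
From HB Require Import structures.
From mathcomp Require Import all_boot all_order all_algebra all_fingroup.
From mathcomp Require Import all_classical all_reals all_analysis.
From mathcomp Require Import complex.
Set Implicit Arguments.
Unset Strict Implicit.
Unset Printing Implicit Defensive.
Import Order.TTheory GRing.Theory Num.Theory.
Import numFieldNormedType.Exports.

Local Open Scope classical_set_scope.
Local Open Scope ring_scope.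
Local Open Scope complex_scope.

(* R[i] carries no structure of normed module over R in the library, so the
   limits of R[i]-valued maps (continuity, directional derivatives, integrals)
   are taken on the real and imaginary parts. *)
Section ComplexValued.
Context {R : realType} {V : normedModType R}.
Implicit Types (F : V -> R[i]) (p v : V) (vs : seq V) (U : set V).

Definition ccontinuous_at F p :=
  {for p, continuous (fun q => complex.Re (F q))} /\
  {for p, continuous (fun q => complex.Im (F q))}.

Definition cderivable F p v :=
  derivable (fun q => complex.Re (F q)) p v /\
  derivable (fun q => complex.Im (F q)) p v.

Definition cderive v F p : R[i] :=
  @Complex R ('D_v (fun q => complex.Re (F q)) p)
             ('D_v (fun q => complex.Im (F q)) p).

(* iter_derive [:: v1; ...; vr] F = D_v1 (D_v2 (... (D_vr F))) *)
Definition iter_derive vs F : V -> R[i] := foldr cderive F vs.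

Fixpoint iter_derivable U vs F : Prop :=
  if vs is v :: vs' then
    iter_derivable U vs' F /\
    forall p, U p -> cderivable (iter_derive vs' F) p v
  else True.

End ComplexValued.

Definition cintegral {R : realType} (h : R -> R[i]) : R[i] :=
  @Complex R (\int[@lebesgue_measure R]_t complex.Re (h t))
             (\int[@lebesgue_measure R]_t complex.Im (h t)).

Section SchwartzTensorFields.
Context {R : realType} {n : nat}.

Definition basis_vec (i : 'I_n) : 'rV[R]_n := delta_mx 0 i.

Definition smooth (g : 'rV[R]_n -> R[i]) :=
  forall w : seq 'I_n,
    iter_derivable setT (map basis_vec w) g /\
    forall x, ccontinuous_at (iter_derive (map basis_vec w) g) x.

(* |x^a D^w g(x)| is bounded for all multi-indices a and all iterated partial
   derivatives D^w. *)
Definition schwartz (g : 'rV[R]_n -> R[i]) :=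
  smooth g /\
  forall (a : 'I_n -> nat) (w : seq 'I_n), exists B : R,
    forall x : 'rV[R]_n,
    `|(\prod_(i < n) x 0 i ^+ a i)%:C * iter_derive (map basis_vec w) g x|
      <= B%:C.

Definition permute {m} (s : 'S_m) (I : m.-tuple 'I_n) : m.-tuple 'I_n :=
  [tuple tnth I (s k) | k < m].

Record symtensor (m : nat) := SymTensor {
  coordinate :> m.-tuple 'I_n -> R[i];
  _ : forall (s : 'S_m) I, coordinate (permute s I) = coordinate I }.

Definition schwartz_field {m} (f : 'rV[R]_n -> symtensor m) :=
  forall I : m.-tuple 'I_n, schwartz (fun x => f x I).

(* The identification of C with the symmetric tensors of rank 0. *)
Definition scalar_tensor (c : R[i]) : symtensor 0 :=
  @SymTensor 0 (fun=> c) (fun _ _ => erefl).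

Definition symmetrize {m} (u : m.-tuple 'I_n -> R[i]) (I : m.-tuple 'I_n) :
    R[i] := (m`!%:R)^-1 * \sum_(s : 'S_m) u (permute s I).

(* <u, xi^m> *)
Definition pairing {m} (u : symtensor m) (xi : 'rV[R]_n) : R[i] :=
  \sum_(I : m.-tuple 'I_n) u I * \prod_(k < m) (xi 0 (tnth I k))%:C.

Definition momentum_ray {m} (k : nat) (f : 'rV[R]_n -> symtensor m)
    (p : 'rV[R]_n * 'rV[R]_n) : R[i] :=
  cintegral (fun t : R => (t ^+ k)%:C * pairing (f (p.1 + t *: p.2)) p.2).

Definition ray {m} (f : 'rV[R]_n -> symtensor m) := momentum_ray 0 f.

Definition ray_domain : set ('rV[R]_n * 'rV[R]_n) := [set p | p.2 != 0].

Definition dir_x (i : 'I_n) : 'rV[R]_n * 'rV[R]_n := (basis_vec i, 0).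
Definition dir_xi (i : 'I_n) : 'rV[R]_n * 'rV[R]_n := (0, basis_vec i).

(* The directions x^{i_1}, ..., x^{i_k}, xi^{i_(k+1)}, ..., xi^{i_m}. *)
Definition mixed_dirs {m} (k : nat) (I : m.-tuple 'I_n) :
    seq ('rV[R]_n * 'rV[R]_n) :=
  map dir_x (take k I) ++ map dir_xi (drop k I).

End SchwartzTensorFields.
Arguments symtensor R n m : clear implicits.

(* Main.v *)
(* On [xi <> 0] the derivatives of the moments
   [A_k g (x, xi) = \int t^k g(x + t xi) dt] of a Schwartz function are taken
   under the integral sign: [d/dx^i A_k g = A_k (d_i g)] and
   [d/dxi^i A_k g = A_(k+1) (d_i g)].  So, on [J^k f], each [d/dxi^i] splits as
   [a_i + b_i], where [a_i] differentiates the factor [xi^m] and [b_i] acts on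
   the moments, and [d/dx^i J^k f] is [b_i J^(k-1) f].  After symmetrization a
   product of [a]'s and [b]'s depends only on the number of [b]'s, and
   [\sum_k (-1)^k C(m, k) b^k (a + b)^(m - k) = a^m]; finally
   [a_(i_1) ... a_(i_m)] turns [<f, xi^m>] into [m! f_(i_1 ... i_m)].

   The symmetrization also absorbs the order of differentiation, so the symmetry
   of second derivatives is never used. *)
Require Import Defs.
From HB Require Import structures.
From mathcomp Require Import all_boot all_order all_algebra all_fingroup.
From mathcomp Require Import all_classical all_reals all_analysis.
From mathcomp Require Import complex measurable_realfun.
From mathcomp Require Import ring lra.
Set Implicit Arguments.
Unset Strict Implicit.
Import Order.TTheory GRing.Theory Num.Theory.
Import numFieldNormedType.Exports.
Local Open Scope classical_set_scope.
Local Open Scope ring_scope.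
Local Open Scope complex_scope.

(** * Differentiation of moments under the integral sign *)

(** The two difference quotients coincide. Directional derivatives thus become derivatives in one
    real parameter, to which the chain rule and differentiation under the integral apply. *)
Lemma is_derive_line (R : realType) (V : normedModType R) (F : V -> R)
    (p v : V) (d : R) :
  is_derive (0 : R) 1 (fun h : R => F (p + h *: v)) d <-> is_derive p v F d.
Proof.
have eq_quot : (fun h : R => h^-1 *:
      (((fun h : R => F (p + h *: v)) \o shift 0) (h *: (1 : R)) -
       F (p + (0 : R) *: v))) =
    (fun h : R => h^-1 *: ((F \o shift p) (h *: v) - F p)).
  apply/funext => h /=.
  congr (_ *: (F _ - F _)); last by rewrite scale0r addr0.
  by rewrite addr0 addrC; congr (_ *: _ + _); rewrite /GRing.scale/= mulr1.
split=> -[]; rewrite /derivable /derive.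
- by rewrite eq_quot => Fp Fd; apply: DeriveDef.
- by rewrite -eq_quot => Fp Fd; apply: DeriveDef.
Qed.

(** The function is even and its integral over the half-line is finite. Its multiples dominate the
    integrands below. *)
Lemma integrable_oneDsqrV (R : realType) :
  (@lebesgue_measure R).-integrable [set: R] (fun x : R => ((oneDsqr x)^-1)%:E).
Proof.
have mV : measurable_fun setT (fun x : R => ((oneDsqr x)^-1)%:E).
  apply/measurable_EFinP; apply: continuous_measurable_fun.
  exact: continuous_oneDsqrV.
apply/integrableP; split => //.
apply/abse_integralP => //=.
rewrite ge0_symfun_integralT//=.
- rewrite (_ : [set x | _] = `[0, +oo[%classic); last first.
    by apply/seteqP; split => x/=; rewrite in_itv/= andbT.
  by rewrite integral0y_oneDsqr -EFinM/= ltry.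
- exact: continuous_oneDsqrV.
- by move=> x /=; rewrite /oneDsqr sqrrN.
Qed.

Section RayDerivative.
Context {R : realType} {n : nat}.
Implicit Types (psi : 'rV[R]_n -> R) (x xi : 'rV[R]_n) (i : 'I_n).

(** Powers of one coordinate at a time suffice: along a line with [xi 0 l != 0], the [l]-th
    coordinate already controls [t]. *)
Definition rapidly_decreasing psi :=
  forall (l : 'I_n) (N : nat), exists B : R,
    forall x, `|x 0 l ^+ N * psi x| <= B.

Lemma exprD1_le (a : R) N : 0 <= a -> (1 + a) ^+ N <= 2 ^+ N * (1 + a ^+ N).
Proof.
move=> a0; have aN0 : 0 <= a ^+ N by rewrite exprn_ge0.
have [a1|/ltW a1] := leP a 1.
  apply: (@le_trans _ _ (2 ^+ N)).
    by apply: lerXn2r; rewrite ?nnegrE; lra.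
  by rewrite ler_peMr ?exprn_ge0// lerDl.
apply: (@le_trans _ _ (2 ^+ N * a ^+ N)).
  by rewrite -exprMn; apply: lerXn2r; rewrite ?nnegrE; lra.
by rewrite ler_wpM2l ?exprn_ge0// lerDr.
Qed.

(** [eps] tells what moves by [h] along [basis_vec i]: the base point ([false]) or [xi] ([true]),
    which displaces the point by [h * t]. Solving the [l]-th coordinate for [t * xi 0 l], the
    perturbation costs at most half of [|xi 0 l| * (1 + |t|)] and is absorbed. *)
Lemma ray_coordinate_bound (eps : bool) i l x xi : xi 0 l != 0 ->
  exists delta M : R, [/\ 0 < delta, 0 <= M &
    forall h t : R, `|h| < delta ->
      `|t| <= M * (1 + `|(x + t *: xi + (h * t ^+ eps) *: basis_vec i) 0 l|)].
Proof.
move=> xil0; have nxi : 0 < `|xi 0 l| by rewrite normr_gt0.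
(* After absorption, [|xi_l| / 2 * |t|] is at most [|y_l| + |x_l| + |xi_l| / 2], hence at most
   [(1 + |x_l| + |xi_l| / 2) * (1 + |y_l|)]; division gives the second witness. *)
exists (`|xi 0 l| / 2), ((1 + `|x 0 l| + `|xi 0 l| / 2) / (`|xi 0 l| / 2)).
split.
- by rewrite divr_gt0.
- rewrite divr_ge0 ?addr_ge0// ?divr_ge0// ltW// divr_gt0//.
move=> h t hd.
pose y := (x + t *: xi + (h * t ^+ eps) *: basis_vec i) 0 l.
rewrite -/y.
have yE : t * xi 0 l = y - x 0 l - h * t ^+ eps * (l == i)%:R.
  by rewrite /y /basis_vec !mxE eqxx/=; ring.
have teps : `|h * t ^+ eps * (l == i)%:R| <= `|xi 0 l| / 2 * (1 + `|t|).
  rewrite !normrM.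
  have le1 : `|(l == i)%:R : R| <= 1 by case: (l == i); rewrite ?normr1 ?normr0.
  rewrite -[leRHS]mulr1 ler_pM ?mulr_ge0// ler_pM// ?(ltW hd)//.
  by clear; case: eps => /=; rewrite ?expr1 ?expr0 ?normr1 ?lerDl ?lerDr.
have : `|t| * `|xi 0 l| <= `|y| + `|x 0 l| + `|xi 0 l| / 2 * (1 + `|t|).
  rewrite -normrM yE; apply: (le_trans (ler_normB _ _)).
  by apply: lerD => //; exact: ler_normB.
have y0 : 0 <= `|y| by []. have x0 : 0 <= `|x 0 l| by [].
move: (`|t|) (`|y|) (`|x 0 l|) (`|xi 0 l|) nxi y0 x0 => T Y X Z Z0 Y0 X0 H.
rewrite mulrAC ler_pdivlMr ?divr_gt0//.
by nra.
Qed.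

Lemma row_neq0 xi : xi != 0 -> exists l, xi 0 l != 0.
Proof.
move=> xi0; apply/existsP; apply: contra_neqT xi0.
rewrite negb_exists => /forallP H; apply/rowP => l.
by rewrite mxE; move: (H l); rewrite negbK => /eqP.
Qed.

(** The bound is uniform in [h], as domination requires: growth of [t] forces growth of the [l]-th
    coordinate, where [psi] decays. *)
Lemma ray_decay (psi : 'rV[R]_n -> R) (eps : bool) (k : nat) i x xi :
  rapidly_decreasing psi -> xi != 0 ->
  exists delta C : R, [/\ 0 < delta, 0 <= C & forall h t : R, `|h| < delta ->
    `|t ^+ k * psi (x + t *: xi + (h * t ^+ eps) *: basis_vec i)| <=
      C * (oneDsqr t)^-1].
Proof.
move=> dpsi /row_neq0[l xil0].
have [delta [M [d0 M0 tM]]] := @ray_coordinate_bound eps i l x xi xil0.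
have bnd N : exists C : R, 0 <= C /\ forall h t : R, `|h| < delta ->
    `|t| ^+ N * `|psi (x + t *: xi + (h * t ^+ eps) *: basis_vec i)| <= C.
  have [B0 HB0] := dpsi l 0%N; have [BN HBN] := dpsi l N.
  have B00 : 0 <= B0 by exact: le_trans (HB0 0).
  have BN0 : 0 <= BN by exact: le_trans (HBN 0).
  (* [M ^+ N] comes from the bound on [|t|] and [2 ^+ N] from [exprD1_le], which leaves the powers 0
     and [N] of [y 0 l], controlled by [B0] and [BN]. *)
  exists (M ^+ N * (2 ^+ N * (B0 + BN))); split.
    by rewrite !mulr_ge0 ?exprn_ge0// addr_ge0.
  move=> h t hd; move: (tM h t hd).
  set y := (_ + _ + _) => ty.
  apply: (@le_trans _ _ ((M * (1 + `|y 0 l|)) ^+ N * `|psi y|)).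
    by rewrite ler_wpM2r// lerXn2r// nnegrE// mulr_ge0// addr_ge0.
  rewrite exprMn -mulrA ler_wpM2l ?exprn_ge0//.
  apply: (@le_trans _ _ (2 ^+ N * (1 + `|y 0 l| ^+ N) * `|psi y|)).
    by rewrite ler_wpM2r// exprD1_le.
  rewrite -mulrA ler_wpM2l ?exprn_ge0// mulrDl lerD//.
    by move: (HB0 y); rewrite expr0 normrM normr1.
  by move: (HBN y); rewrite normrM normrX.
(* The exponents [k] and [k + 2] add up to [|t| ^ k * (1 + t ^ 2)]. *)
have [C1 [C10 HC1]] := bnd k; have [C2 [C20 HC2]] := bnd k.+2.
exists delta, (C1 + C2); split; rewrite ?addr_ge0// => h t hd.
have one0 : 0 < oneDsqr t by exact: lt_le_trans (oneDsqr_ge1 t).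
rewrite -ler_pdivrMr ?invr_gt0// invrK normrM normrX.
rewrite /oneDsqr mulrDr mulr1 lerD ?HC1//.
by rewrite mulrAC -(real_normK (num_real t)) -exprD addn2 HC2.
Qed.

Lemma continuous_ray psi (eps : bool) (k : nat) i x xi h : continuous psi ->
  continuous (fun t : R =>
    t ^+ k * psi (x + t *: xi + (h * t ^+ eps) *: basis_vec i)).
Proof.
move=> cpsi t.
apply: (@continuousM _ _ (fun t : R => t ^+ k) (fun t : R =>
  psi (x + t *: xi + (h * t ^+ eps) *: basis_vec i))).
  exact: exprn_continuous.
apply: (@continuous_comp _ _ _ (fun t : R =>
  x + t *: xi + (h * t ^+ eps) *: basis_vec i) psi); last exact: cpsi.
apply: continuousD.
  apply: continuousD; first exact: cst_continuous.
  exact: scalel_continuous.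
apply: (@continuous_comp _ _ _ (fun t : R => h * t ^+ eps)
  (fun r : R => r *: (basis_vec i : 'rV[R]_n))); last exact: scalel_continuous.
apply: (@continuous_comp _ _ _ (fun t : R => t ^+ eps) (fun r : R => h * r)).
  exact: exprn_continuous.
exact: mulrl_continuous.
Qed.

Lemma integrable_oneDsqr_dom (u : R -> R) (C : R) : continuous u ->
  (forall t, `|u t| <= C * (oneDsqr t)^-1) ->
  (@lebesgue_measure R).-integrable [set: R] (EFin \o u).
Proof.
move=> cu uC.
pose g : R -> \bar R := EFin \o (fun t : R => C * (oneDsqr t)^-1).
apply: (@le_integrable _ _ _ (@lebesgue_measure R) [set: R] measurableT _ g).
- by apply/measurable_EFinP; exact: continuous_measurable_fun.
- by move=> t _ /=; rewrite lee_fin (le_trans (uC t))// ler_norm.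
- have -> : g = (fun t : R => C%:E * ((oneDsqr t)^-1%R)%:E)%E.
    by apply/funext => t; rewrite /g/= EFinM.
  by apply: integrableZl => //; exact: integrable_oneDsqrV.
Qed.

Definition ray_moment (k : nat) psi (p : 'rV[R]_n * 'rV[R]_n) : R :=
  \int[@lebesgue_measure R]_t (t ^+ k * psi (p.1 + t *: p.2)).

Lemma ray_integrable psi (k : nat) x xi :
  continuous psi -> rapidly_decreasing psi -> xi != 0 ->
  (@lebesgue_measure R).-integrable [set: R]
    (EFin \o (fun t : R => t ^+ k * psi (x + t *: xi))).
Proof.
move=> cpsi dpsi xi0.
have [l _] := row_neq0 xi0.
have [d [C [d0 C0 HC]]] := @ray_decay psi false k l x xi dpsi xi0.
have ray0 t : t ^+ k * psi (x + t *: xi) =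
    t ^+ k * psi (x + t *: xi + (0 * t ^+ false) *: basis_vec l).
  by rewrite mul0r scale0r addr0.
apply: (@integrable_oneDsqr_dom _ C) => [|t].
  by under eq_fun do rewrite ray0; exact: continuous_ray.
by rewrite ray0; apply: HC; rewrite normr0.
Qed.

(** The chain rule produces the factor [t ^+ eps], so a derivative in [xi] raises the order of the
    moment by one and a derivative in [x] keeps it. [ray_decay] supplies the domination. *)
Lemma is_derive_ray_moment psi psi' (eps : bool) (k : nat) i x xi :
  (forall y, is_derive y (basis_vec i) psi (psi' y)) ->
  continuous psi -> rapidly_decreasing psi -> rapidly_decreasing psi' ->
  xi != 0 ->
  is_derive (x, xi) (if eps then dir_xi i else dir_x i) (ray_moment k psi)
    (ray_moment (eps + k) psi' (x, xi)).
Proof.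
move=> psiD cpsi dpsi dpsi' xi0; apply/is_derive_line.
pose F (h t : R) := t ^+ k * psi (x + t *: xi + (h * t ^+ eps) *: basis_vec i).
have FE : (fun h : R => ray_moment k psi
      ((x, xi) + h *: (if eps then dir_xi i else dir_x i))) =
    (fun h => \int[@lebesgue_measure R]_t F h t).
  apply/funext => h; apply: eq_Rintegral => t _; rewrite /F.
  congr (_ * psi _); clear F.
  case: eps => /=; rewrite ?scaler0 ?addr0 ?expr1 ?expr0.
    by rewrite scalerDr addrA scalerA mulrC.
  by rewrite mulr1 addrAC.
rewrite {}FE.
have FD (h t : R) : is_derive h 1 (F ^~ t)
    (t ^+ (eps + k) * psi' (x + t *: xi + (h * t ^+ eps) *: basis_vec i)).
  apply/is_derive_line.
  pose y := x + t *: xi + (h * t ^+ eps) *: basis_vec i.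
  have Fy : (fun s : R => F (h + s *: 1) t) =
      t ^+ k *: (fun s : R => (fun r : R => psi (y + r *: basis_vec i))
        (s * t ^+ eps)).
    apply/funext => s; rewrite /F /y; congr (_ * psi _).
    rewrite -[in RHS]addrA -scalerDl -mulrDl; congr (_ + (h + _) * _ *: _).
    by rewrite /GRing.scale/= mulr1.
  rewrite Fy.
  have H1 : is_derive (0 : R) 1 (fun s : R => s * t ^+ eps) (t ^+ eps).
    rewrite (_ : (fun s : R => s * t ^+ eps) = t ^+ eps \*: id); last first.
      by apply/funext => s; rewrite /= mulrC.
    by apply: is_derive_eq; rewrite /GRing.scale/= mulr1.
  have H2 : is_derive ((0 : R) * t ^+ eps) 1
      (fun r : R => psi (y + r *: basis_vec i)) (psi' y).
    by rewrite mul0r; apply/is_derive_line.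
  have H3 := @is_derive1_comp _ (fun r : R => psi (y + r *: basis_vec i))
    (fun s : R => s * t ^+ eps) 0 _ _ H2 H1.
  apply: (is_derive_eq (is_deriveZ (t ^+ k) H3)).
  by rewrite /GRing.scale/= exprD mulrCA mulrA mulrC mulrA mulrAC.
have [d1 [C1 [d10 C10 HC1]]] := @ray_decay psi eps k i x xi dpsi xi0.
have [d2 [C2 [d20 C20 HC2]]] := @ray_decay psi' eps (eps + k) i x xi dpsi' xi0.
(* On []-d, d[] the bound for [psi] makes each [F h] integrable, and the bound for [psi'] dominates
   the derivative in [h]. *)
pose d := Num.min d1 d2.
have d0 : 0 < d by rewrite lt_min d10.
have itvP (h : R) : `]-d, d[%classic h -> `|h| < d1 /\ `|h| < d2.
  by rewrite /= in_itv/= -ltr_norml lt_min => /andP.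
have I0 : `]-d, d[%classic (0 : R) by rewrite /= in_itv/= oppr_lt0 d0.
have intF (h : R) : `]-d, d[%classic h ->
    (@lebesgue_measure R).-integrable [set: R] (EFin \o F h).
  move=> /itvP[h1 _]; apply: (@integrable_oneDsqr_dom _ C1).
    exact: continuous_ray.
  by move=> t; exact: HC1.
have derF (h t : R) : `]-d, d[%classic h -> setT t -> derivable (F ^~ t) h 1.
  by move=> _ _; have [] := FD h t.
have G0 (t : R) : 0 <= C2 * (oneDsqr t)^-1.
  by rewrite mulr_ge0// invr_ge0 (le_trans _ (oneDsqr_ge1 t)).
have intG : (@lebesgue_measure R).-integrable [set: R]
    (EFin \o (fun t => C2 * (oneDsqr t)^-1)).
  apply: (@integrable_oneDsqr_dom _ C2) => [t|t].
    apply: (@continuous_comp _ _ _ (fun t : R => (oneDsqr t)^-1)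
      (fun r : R => C2 * r)); last exact: mulrl_continuous.
    exact: continuous_oneDsqrV.
  by rewrite ger0_norm.
have Gub (h t : R) : `]-d, d[%classic h -> setT t ->
    `|partial1of2 F h t| <= C2 * (oneDsqr t)^-1.
  move=> /itvP[_ h2] _; rewrite partial1of2E.
  by have [_ ->] := FD h t; exact: HC2.
apply: DeriveDef.
  exact: (derivable_under_integral measurableT I0 intF derF G0 intG Gub).
rewrite -derive1E.
rewrite (differentiation_under_integral measurableT I0 intF derF G0 intG Gub).
apply: eq_Rintegral => t _; rewrite partial1of2E.
by have [_ ->] := FD 0 t; rewrite mul0r scale0r addr0.
Qed.

End RayDerivative.
(** * Complex-valued derivatives and moments *)

Section ComplexParts.
Context {R : realType}.
Implicit Types (z : R[i]) (r : R).

Lemma ReD z1 z2 : complex.Re (z1 + z2) = complex.Re z1 + complex.Re z2.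
Proof. by case: z1 z2 => ? ? []. Qed.

Lemma ImD z1 z2 : complex.Im (z1 + z2) = complex.Im z1 + complex.Im z2.
Proof. by case: z1 z2 => ? ? []. Qed.

Lemma ReM_real r z : complex.Re (r%:C * z) = r * complex.Re z.
Proof. by case: z => ? ? /=; rewrite mul0r subr0. Qed.

Lemma ImM_real r z : complex.Im (r%:C * z) = r * complex.Im z.
Proof. by case: z => ? ? /=; rewrite mul0r addr0. Qed.

Lemma complex_ext z1 z2 :
  complex.Re z1 = complex.Re z2 -> complex.Im z1 = complex.Im z2 -> z1 = z2.
Proof. by case: z1 z2 => ? ? [? ?] /= -> ->. Qed.

Lemma normr_Re_le z (B : R) : `|z| <= B%:C -> `|complex.Re z| <= B.
Proof. by move=> zB; rewrite -lecR (le_trans (normc_ge_Re z)). Qed.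

(** Multiplication by the imaginary unit turns the imaginary part into minus a real part and
    preserves the modulus. *)
Lemma normr_Im_le z (B : R) : `|z| <= B%:C -> `|complex.Im z| <= B.
Proof.
move=> zB; rewrite -normrN -ReiNIm; apply: normr_Re_le.
by rewrite normrM [`|Complex 0 1|]normc_def /= expr0n expr1n add0r sqrtr1 mulr1.
Qed.

End ComplexParts.

Section ComplexDerivative.
Context {R : realType} {V : normedModType R}.
Implicit Types (F G : V -> R[i]) (p v : V) (D : R[i]).

Definition is_cderive p v F D :=
  is_derive p v (fun q => complex.Re (F q)) (complex.Re D) /\
  is_derive p v (fun q => complex.Im (F q)) (complex.Im D).

Lemma is_cderive_cderivable p v F D : is_cderive p v F D -> cderivable F p v.
Proof. by move=> [[? _] [? _]]. Qed.

Lemma is_cderive_val p v F D : is_cderive p v F D -> cderive v F p = D.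
Proof. by move=> [[_ eRe] [_ eIm]]; apply: complex_ext. Qed.

Lemma cderivableP p v F : cderivable F p v -> is_cderive p v F (cderive v F p).
Proof. by move=> [dRe dIm]; split; exact: derivableP. Qed.

Lemma is_cderiveD p v F G DF DG : is_cderive p v F DF -> is_cderive p v G DG ->
  is_cderive p v (fun q => F q + G q) (DF + DG).
Proof.
move=> [FR FI] [GR GI]; split.
  rewrite ReD; rewrite (_ : (fun q => _) =
    (fun q => complex.Re (F q)) + (fun q => complex.Re (G q))).
    exact: is_deriveD.
  by apply/funext => q; rewrite ReD.
rewrite ImD; rewrite (_ : (fun q => _) =
  (fun q => complex.Im (F q)) + (fun q => complex.Im (G q))).
  exact: is_deriveD.
by apply/funext => q; rewrite ImD.
Qed.

Lemma is_cderive_sum (T : eqType) (s : seq T) (F : T -> V -> R[i])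
    (D : T -> R[i]) p v : (forall K, K \in s -> is_cderive p v (F K) (D K)) ->
  is_cderive p v (fun q => \sum_(K <- s) F K q) (\sum_(K <- s) D K).
Proof.
elim: s => [|K s IHs] FD.
  rewrite big_nil.
  under [fun q => _]eq_fun do rewrite big_nil.
  by split; exact: is_derive_cst.
rewrite big_cons; under [fun q => _]eq_fun do rewrite big_cons.
apply: is_cderiveD; first by apply: FD; rewrite mem_head.
by apply: IHs => K' sK'; apply: FD; rewrite in_cons sK' orbT.
Qed.

Lemma is_cderiveM_real (a : V -> R) (da : R) p v F D :
  is_derive p v a da -> is_cderive p v F D ->
  is_cderive p v (fun q => (a q)%:C * F q) (da%:C * F p + (a p)%:C * D).
Proof.
move=> Da [FR FI]; split.
  rewrite ReD !ReM_real; rewrite (_ : (fun q => _) =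
    a * (fun q => complex.Re (F q))); last first.
    by apply/funext => q; rewrite ReM_real.
  apply: (is_derive_eq (is_deriveM Da FR)).
  by rewrite /GRing.scale/= addrC mulrC.
rewrite ImD !ImM_real; rewrite (_ : (fun q => _) =
  a * (fun q => complex.Im (F q))); last first.
  by apply/funext => q; rewrite ImM_real.
apply: (is_derive_eq (is_deriveM Da FI)).
by rewrite /GRing.scale/= addrC mulrC.
Qed.

Lemma is_cderive_eq p v F D D' : is_cderive p v F D -> D = D' ->
  is_cderive p v F D'.
Proof. by move=> ? <-. Qed.

Lemma is_cderive_nat (c : nat) p v F D : is_cderive p v F D ->
  is_cderive p v (fun q => c%:R * F q) (c%:R * D).
Proof.
move=> FD; have cR : c%:R = (c%:R : R)%:C :> R[i] by rewrite rmorph_nat.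
rewrite cR; have := is_cderiveM_real (is_derive_cst (c%:R : R) p v) FD.
by move=> H; apply: (is_cderive_eq H); rewrite mul0r add0r.
Qed.

(** Formulas for iterated derivatives hold only where [xi] is nonzero, an open set; there a function
    may be replaced by its formula before the next derivative is taken. *)
Lemma is_cderive_local (U : set V) p v F G D : open U -> U p ->
  (forall q, U q -> G q = F q) -> is_cderive p v F D -> is_cderive p v G D.
Proof.
move=> oU Up FG [FR FI].
have UN : \forall q \near p, U q by exact: open_nbhs_nbhs.
by split; [apply: near_eq_is_derive FR|apply: near_eq_is_derive FI];
  apply: filterS UN => q Uq; rewrite FG.
Qed.

End ComplexDerivative.

Section ComplexIntegral.
Context {R : realType}.
Implicit Types (h : R -> R[i]).

Definition cintegrable h :=
  (@lebesgue_measure R).-integrable [set: R]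
    (EFin \o (fun t => complex.Re (h t))) /\
  (@lebesgue_measure R).-integrable [set: R]
    (EFin \o (fun t => complex.Im (h t))).

Lemma eq_cintegral h1 h2 : h1 =1 h2 -> cintegral h1 = cintegral h2.
Proof. by move=> /funext ->. Qed.

Lemma cintegrable0 : cintegrable (fun=> 0).
Proof. by split; exact: integrable0. Qed.

Lemma cintegral0 : cintegral (fun=> 0 : R[i]) = 0.
Proof. by apply: complex_ext; rewrite /= Rintegral_cst//= mul0r. Qed.

Lemma cintegrableD h1 h2 : cintegrable h1 -> cintegrable h2 ->
  cintegrable (fun t => h1 t + h2 t).
Proof.
move=> [R1 I1] [R2 I2]; split.
  rewrite (_ : _ \o _ = (EFin \o (fun t => complex.Re (h1 t))) \+
    (EFin \o (fun t => complex.Re (h2 t))))%E; first exact: integrableD.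
  by apply/funext => t /=; rewrite ReD EFinD.
rewrite (_ : _ \o _ = (EFin \o (fun t => complex.Im (h1 t))) \+
  (EFin \o (fun t => complex.Im (h2 t))))%E; first exact: integrableD.
by apply/funext => t /=; rewrite ImD EFinD.
Qed.

Lemma cintegralD h1 h2 : cintegrable h1 -> cintegrable h2 ->
  cintegral (fun t => h1 t + h2 t) = cintegral h1 + cintegral h2.
Proof.
move=> [R1 I1] [R2 I2]; apply: complex_ext.
  by rewrite ReD /= -RintegralD//; apply: eq_Rintegral => t _; rewrite ReD.
by rewrite ImD /= -RintegralD//; apply: eq_Rintegral => t _; rewrite ImD.
Qed.

Lemma cintegrableZ (c : R) h : cintegrable h ->
  cintegrable (fun t => c%:C * h t).
Proof.
move=> [hR hI]; split.
  rewrite (_ : _ \o _ = (fun t : R => c%:E * (complex.Re (h t))%:E)%E).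
    exact: integrableZl.
  by apply/funext => t; rewrite /= ReM_real EFinM.
rewrite (_ : _ \o _ = (fun t : R => c%:E * (complex.Im (h t))%:E)%E).
  exact: integrableZl.
by apply/funext => t; rewrite /= ImM_real EFinM.
Qed.

Lemma cintegralZ (c : R) h : cintegrable h ->
  cintegral (fun t => c%:C * h t) = c%:C * cintegral h.
Proof.
move=> [hR hI]; apply: complex_ext.
  rewrite ReM_real /= -RintegralZl//.
  by apply: eq_Rintegral => t _; rewrite ReM_real.
rewrite ImM_real /= -RintegralZl//.
by apply: eq_Rintegral => t _; rewrite ImM_real.
Qed.

(** Both claims share one induction, since splitting off a term uses integrability of the remaining
    sum. *)
Lemma cintegral_sum (T : Type) (s : seq T) (h : T -> R -> R[i]) :
  (forall K, cintegrable (h K)) ->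
  cintegrable (fun t => \sum_(K <- s) h K t) /\
  cintegral (fun t => \sum_(K <- s) h K t) = \sum_(K <- s) cintegral (h K).
Proof.
move=> ih; elim: s => [|K s [IH1 IH2]].
  under [fun t : R => _]eq_fun do rewrite big_nil.
  by rewrite big_nil; split; [exact: cintegrable0 | exact: cintegral0].
under [fun t : R => _]eq_fun do rewrite big_cons.
by rewrite big_cons -IH2; split; [exact: cintegrableD | exact: cintegralD].
Qed.

End ComplexIntegral.

(** * Moments of complex-valued Schwartz functions along lines *)

Section SchwartzRay.
Context {R : realType} {n : nat}.
Implicit Types (g : 'rV[R]_n -> R[i]) (w : seq 'I_n).

Definition partials w g := iter_derive (map (@basis_vec R n) w) g.

Lemma schwartz_is_cderive g w i y : schwartz g ->
  is_cderive y (basis_vec i) (partials w g) (partials (i :: w) g y).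
Proof. by move=> [/(_ (i :: w))[[_ gD] _] _]; apply/cderivableP/gD. Qed.

Lemma schwartz_continuous g w : schwartz g ->
  continuous (fun x => complex.Re (partials w g x)) /\
  continuous (fun x => complex.Im (partials w g x)).
Proof. by move=> [/(_ w)[_ gC] _]; split=> x; have [] := gC x. Qed.

Lemma schwartz_rapidly_decreasing g w : schwartz g ->
  rapidly_decreasing (fun x => complex.Re (partials w g x)) /\
  rapidly_decreasing (fun x => complex.Im (partials w g x)).
Proof.
move=> [_ gB]; suff H (l : 'I_n) N : exists B : R, forall x : 'rV[R]_n,
    `|(x 0 l ^+ N)%:C * partials w g x| <= B%:C.
  split=> l N; have [B HB] := H l N; exists B => x.
    by rewrite -ReM_real; exact: normr_Re_le.
  by rewrite -ImM_real; exact: normr_Im_le.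
have [B HB] := gB (fun i => if i == l then N else 0%N) w.
exists B => x; move: (HB x); rewrite (bigD1 l)//= eqxx big1 ?mulr1//.
by move=> i /negbTE ->; rewrite expr0.
Qed.

Definition cray_moment (k : nat) g (p : 'rV[R]_n * 'rV[R]_n) : R[i] :=
  cintegral (fun t : R => (t ^+ k)%:C * g (p.1 + t *: p.2)).

Lemma Re_cray_moment k g p : complex.Re (cray_moment k g p) =
  ray_moment k (fun x => complex.Re (g x)) p.
Proof. by apply: eq_Rintegral => t _; rewrite ReM_real. Qed.

Lemma Im_cray_moment k g p : complex.Im (cray_moment k g p) =
  ray_moment k (fun x => complex.Im (g x)) p.
Proof. by apply: eq_Rintegral => t _; rewrite ImM_real. Qed.

Lemma schwartz_cintegrable k g x xi : schwartz g -> xi != 0 ->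
  cintegrable (fun t : R => (t ^+ k)%:C * g (x + t *: xi)).
Proof.
move=> gS xi0.
have [cR cI] := schwartz_continuous [::] gS.
have [dR dI] := schwartz_rapidly_decreasing [::] gS.
split.
  have := ray_integrable k x cR dR xi0; congr (integrable _ _ (EFin \o _)).
  by apply/funext => t; rewrite ReM_real.
have := ray_integrable k x cI dI xi0; congr (integrable _ _ (EFin \o _)).
by apply/funext => t; rewrite ImM_real.
Qed.

(** Read as a number, the Boolean is the increase in moment order caused by the derivative. *)
Definition dir (eps : bool) (i : 'I_n) : 'rV[R]_n * 'rV[R]_n :=
  if eps then dir_xi i else dir_x i.

Lemma is_cderive_cray_moment (eps : bool) k g w i p : schwartz g ->
  p.2 != 0 ->
  is_cderive p (dir eps i) (cray_moment k (partials w g))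
    (cray_moment (eps + k) (partials (i :: w) g) p).
Proof.
move: p => [x xi] gS xi0.
have [cR cI] := schwartz_continuous w gS.
have [dR dI] := schwartz_rapidly_decreasing w gS.
have [dR' dI'] := schwartz_rapidly_decreasing (i :: w) gS.
have gD y := schwartz_is_cderive w i y gS.
split.
  rewrite (funext (Re_cray_moment _ _)) Re_cray_moment.
  by apply: is_derive_ray_moment => // y; have [] := gD y.
rewrite (funext (Im_cray_moment _ _)) Im_cray_moment.
by apply: is_derive_ray_moment => // y; have [] := gD y.
Qed.

End SchwartzRay.

(** * Derivatives of the momentum ray transforms *)

Section SymmetricPolynomial.
Context {R : realType} {n : nat}.
Implicit Types (u : seq 'I_n -> R[i]) (xi : 'rV[R]_n) (i j : 'I_n).

(** The pairing of [u] with [xi^r], peeled off one index at a time so that it can be differentiated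
    by induction on [r]. *)
Fixpoint sympol (r : nat) u xi : R[i] :=
  if r is r'.+1 then
    \sum_i (xi 0 i)%:C * sympol r' (fun K => u (i :: K)) xi
  else u [::].

Lemma eq_sympol r u u' xi : (forall K, size K = r -> u K = u' K) ->
  sympol r u xi = sympol r u' xi.
Proof.
elim: r u u' => [|r IHr] u u' uu' /=; first exact: uu'.
by apply: eq_bigr => i _; congr (_ * _); apply: IHr => K sK; rewrite uu'//= sK.
Qed.

Lemma big_tuple_cons (T : finType) r (F : r.+1.-tuple T -> R[i]) :
  \sum_t F t = \sum_x \sum_(t : r.-tuple T) F [tuple of x :: t].
Proof.
rewrite pair_bigA/= (reindex (fun p : T * r.-tuple T => [tuple of p.1 :: p.2])).
  by apply: eq_bigr => -[].
exists (fun t => (thead t, [tuple of behead t])) => [[x t] _|t _] /=.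
  by congr (_, _); apply: val_inj.
by rewrite -tuple_eta.
Qed.

Lemma sympolE r u xi : sympol r u xi =
  \sum_(K : r.-tuple 'I_n) u K * \prod_(k < r) (xi 0 (tnth K k))%:C.
Proof.
elim: r u => [|r IHr] u /=.
  rewrite (big_pred1 [tuple]) => [|t]; last by apply/esym/eqP; exact: tuple0.
  by rewrite big_ord0 mulr1.
rewrite big_tuple_cons; apply: eq_bigr => i _.
rewrite IHr mulr_sumr; apply: eq_bigr => K _.
rewrite big_ord_recl mulrCA tnth0; congr (_ * (_ * _)).
by apply: eq_bigr => k _; rewrite tnthS.
Qed.

Lemma is_derive_coordinate (eps : bool) i j (p : 'rV[R]_n * 'rV[R]_n) :
  is_derive p (dir eps i) (fun q => q.2 0 j) (eps && (i == j))%:R.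
Proof.
apply/is_derive_line.
rewrite (_ : (fun h => _) =
    cst (p.2 0 j) + (eps && (i == j))%:R \*: (@id R)).
  by apply: is_derive_eq; rewrite /GRing.scale/= add0r mulr1.
apply/funext => h; rewrite fctE /=.
case: eps => /=; rewrite !mxE ?eqxx/=; last by rewrite mulr0 scale0r.
by rewrite eq_sym mulrC.

Qed.

(** Product rule: the first summand differentiates the coefficients. In the second, each of the [r]
    factors of [xi] gives the same contribution, because symmetry moves the index [i] to the
    front. *)
Lemma is_cderive_sympol (eps : bool) i r
    (u : seq 'I_n -> 'rV[R]_n * 'rV[R]_n -> R[i]) u' p :
  (forall K, size K = r -> is_cderive p (dir eps i) (u K) (u' K)) ->
  (forall K K', size K = r -> perm_eq K K' -> u K p = u K' p) ->
  is_cderive p (dir eps i) (fun q => sympol r (u^~ q) q.2)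
    (sympol r u' p.2 +
     (eps * r)%:R * sympol r.-1 (fun K => u (i :: K) p) p.2).
Proof.
elim: r u u' => [|r IHr] u u' uD usym.
  by rewrite muln0 mul0r addr0; exact: uD.
have H j := is_cderiveM_real (is_derive_coordinate eps i j p)
  (IHr (fun K => u (j :: K)) (fun K => u' (j :: K))
    (fun K sK => uD (j :: K) (congr1 S sK))
    (fun K K' sK KK' => usym (j :: K) (j :: K') (congr1 S sK)
       (etrans (perm_cons j K K') KK'))).
apply: is_cderive_eq.
  apply: is_cderive_sum => j _; exact: H.
rewrite big_split/=.
under [X in _ + X]eq_bigr do rewrite mulrDr.
rewrite big_split/= addrCA; congr (_ + _).
have -> : \sum_j ((eps && (i == j))%:R : R)%:C *
      sympol r (fun K => u (j :: K) p) p.2 =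
    eps%:R * sympol r (fun K => u (i :: K) p) p.2.
  rewrite (bigD1 i)//= eqxx andbT big1 ?addr0 ?rmorph_nat// => j /negbTE.
  by rewrite eq_sym => ->; rewrite andbF mul0r.
rewrite mulnS natrD mulrDl; congr (_ + _).
(* For [r = 0] the coefficient vanishes, so the truncated [r.-1] is harmless; otherwise the indices
   [i] and [j] are exchanged by symmetry. *)
case: r {IHr uD H} usym => [|r] usym.
  by rewrite muln0 mul0r big1// => j _; rewrite mul0r mulr0.
rewrite /= mulr_sumr; apply: eq_bigr => j _; rewrite mulrCA.
congr (_ * (_ * _)).
apply: eq_sympol => K sK; apply: usym => /=; first by rewrite sK.
by apply/seq.permP => a /=; rewrite addnCA.
Qed.

End SymmetricPolynomial.

(** * Moments of a tensor field with some indices fixed *)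

Section Leibniz.
Context {R : realType} {n m : nat}.
Context (f : 'rV[R]_n -> symtensor R n m) (hf : schwartz_field f).
Implicit Types (K c w : seq 'I_n) (p : 'rV[R]_n * 'rV[R]_n).

(* The coordinate of [f] at a list of indices, [0] unless its length is [m]. *)
Definition seq_coordinate K (x : 'rV[R]_n) : R[i] :=
  oapp (fun I : m.-tuple 'I_n => f x I) 0 (insub K).

Lemma seq_coordinateE (I : m.-tuple 'I_n) :
  seq_coordinate I = (fun x => f x I).
Proof. by apply/funext => x; rewrite /seq_coordinate valK. Qed.

Lemma schwartz_seq_coordinate K : size K = m -> schwartz (seq_coordinate K).
Proof. by move=> /eqP sK; rewrite (seq_coordinateE (Tuple sK)); exact: hf. Qed.

Lemma seq_coordinate_perm K K' : size K = m -> perm_eq K K' ->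
  seq_coordinate K = seq_coordinate K'.
Proof.
move=> /eqP sK KK'; have sK' : size K' == m by rewrite -(perm_size KK').
move: KK'; rewrite -[K]/(val (Tuple sK)) -[K']/(val (Tuple sK')).
move=> /tuple_permP[s /val_inj ->].
rewrite !seq_coordinateE; apply/funext => x.
by case: (f x) => u usym /=; rewrite -[RHS](usym s).
Qed.

(* [\int t^k <h(x + t xi), xi^(m - l)> dt] for the tensor field [h] of rank
   [m - l] with [h_(j_1 ...) = D^w f_(c_1 ... c_l j_1 ...)], [l = size c]. *)
Definition contracted_moment k w c p : R[i] :=
  sympol (m - size c)
    (fun K => cray_moment k (partials w (seq_coordinate (c ++ K))) p) p.2.

(** The splitting [a_i + b_i]: the first summand is [b_i], acting on the moments, and the second is
    [a_i], which fixes one more index and is present only for [eps = true]. *)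
Lemma is_cderive_contracted_moment (eps : bool) i k w c p :
  (size c <= m)%N -> p.2 != 0 ->
  is_cderive p (dir eps i) (contracted_moment k w c)
    (contracted_moment (eps + k) (i :: w) c p +
     (eps * (m - size c))%:R * contracted_moment k w (i :: c) p).
Proof.
move=> sc p0; set r := (m - size c)%N.
have sz K : size K = r -> size (c ++ K) = m.
  by move=> sK; rewrite size_cat sK subnKC.
have uD K : size K = r -> is_cderive p (dir eps i)
    (cray_moment k (partials w (seq_coordinate (c ++ K))))
    (cray_moment (eps + k) (partials (i :: w) (seq_coordinate (c ++ K))) p).
  by move=> /sz/schwartz_seq_coordinate/is_cderive_cray_moment; exact.
have usym K K' : size K = r -> perm_eq K K' ->
    cray_moment k (partials w (seq_coordinate (c ++ K))) p =
    cray_moment k (partials w (seq_coordinate (c ++ K'))) p.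
  move=> /sz sK KK'; congr cray_moment; congr partials.
  by apply: seq_coordinate_perm => //; rewrite perm_cat2l.
apply: (is_cderive_eq (is_cderive_sympol uD usym)).
congr (_ + _).
(* When no free index is left, the factor [m - size c] is zero and hides the truncated
   subtraction. *)
have [r0|r0] := posnP r; first by rewrite r0 muln0 !mul0r.
congr (_ * _); rewrite /contracted_moment /= subnS; apply: eq_sympol => K sK.
congr cray_moment; congr partials; apply: seq_coordinate_perm.
  by apply: sz; rewrite /= sK prednK.
by rewrite -cat1s perm_catCA.
Qed.

(** The powers of [xi] are constant in [t] and leave the integral; [xi] nonzero makes each term
    integrable, so sum and integral may be exchanged. *)
Lemma momentum_rayE k p : p.2 != 0 ->
  momentum_ray k f p = contracted_moment k [::] [::] p.
Proof.
move=> p0; rewrite /contracted_moment subn0 sympolE.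
pose P (K : m.-tuple 'I_n) := \prod_(k < m) p.2 0 (tnth K k).
have PE (K : m.-tuple 'I_n) : \prod_(k < m) (p.2 0 (tnth K k))%:C = (P K)%:C.
  by rewrite rmorph_prod.
pose h (K : m.-tuple 'I_n) (t : R) :=
  (t ^+ k)%:C * f (p.1 + t *: p.2) K.
have ih (K : m.-tuple 'I_n) : cintegrable (h K).
  exact: (schwartz_cintegrable k p.1 (hf K) p0).
rewrite /momentum_ray.
rewrite (eq_cintegral
  (h2 := fun t => \sum_(K : m.-tuple 'I_n) (P K)%:C * h K t)).
  have [|_ ->] := cintegral_sum (index_enum _) 
    (h := fun (K : m.-tuple 'I_n) t => (P K)%:C * h K t).
    by move=> K; apply: cintegrableZ.
  apply: eq_bigr => K _; rewrite cintegralZ// PE mulrC; congr (_ * _).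
  by rewrite /cray_moment seq_coordinateE.
move=> t; rewrite /pairing mulr_sumr; apply: eq_bigr => K _.
by rewrite PE /h mulrA mulrC.
Qed.

Lemma open_ray_domain : open (@ray_domain R n).
Proof.
rewrite (_ : ray_domain = snd @^-1` (~` [set (0 : 'rV[R]_n)])); last first.
  by apply/seteqP; split => p /= /eqP.
apply: open_comp; first by move=> p _; exact: cvg_snd.
rewrite openC; apply: accessible_closed_set1.
by apply: hausdorff_accessible; exact: norm_hausdorff.
Qed.

End Leibniz.

(** * Leibniz expansion and symmetrization *)

Section Bitseqs.

(** One word for each term of an expanded product of [r] binomials [a + b], with [true] standing for
    [b]. *)
Fixpoint bitseqs (r : nat) : seq bitseq :=
  if r is r'.+1 then
    map (cons true) (bitseqs r') ++ map (cons false) (bitseqs r')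
  else [:: [::]].

Lemma size_bitseqs r b : b \in bitseqs r -> size b = r.
Proof.
elim: r b => [|r IHr] b /=; first by rewrite inE => /eqP ->.
by rewrite mem_cat => /orP[] /mapP[b' /IHr <- ->].
Qed.

Lemma big_bitseqsS (A : nmodType) r (F : bitseq -> A) :
  \sum_(b <- bitseqs r.+1) F b =
  \sum_(b <- bitseqs r) (F (true :: b) + F (false :: b)).
Proof. by rewrite /= big_cat !big_map big_split. Qed.

Lemma sum_bitseqs_Xn (A : comNzRingType) r :
  \sum_(b <- bitseqs r) 'X^(count id b) = ('X + 1) ^+ r :> {poly A}.
Proof.
elim: r => [|r IHr]; first by rewrite big_seq1.
rewrite big_bitseqsS exprS -IHr mulrDl mul1r mulr_sumr -big_split/=.
by apply: eq_bigr => b _; rewrite add1n add0n exprS.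
Qed.

(* The image of [((1 + X) - X)^m = 1] under the linear form [X^j |-> phi j]. *)
Lemma alternating_bitseqs_sum (A : comNzRingType) m (phi : nat -> A) :
  \sum_(k < m.+1) (-1) ^+ k * 'C(m, k)%:R *
    \sum_(b <- bitseqs (m - k)) phi (k + count id b)%N = phi 0%N.
Proof.
(* Coefficients up to degree [m] suffice, since [k + count id b <= m] for every [b] in
   [bitseqs (m - k)]. *)
pose L (p : {poly A}) := \sum_(i < m.+1) p`_i * phi i.
have LD p q : L (p + q) = L p + L q.
  by rewrite -big_split; apply: eq_bigr => i _; rewrite coefD mulrDl.
have L0 : L 0 = 0 by rewrite /L big1// => i _; rewrite coef0 mul0r.
have LZ c p : L (c *: p) = c * L p.
  by rewrite /L mulr_sumr; apply: eq_bigr => i _; rewrite coefZ mulrA.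
have Lsum (T : Type) (s : seq T) (F : T -> {poly A}) :
    L (\sum_(x <- s) F x) = \sum_(x <- s) L (F x).
  exact: (big_morph L LD L0).
have LX j : (j <= m)%N -> L 'X^j = phi j.
  move=> jm; rewrite /L (bigD1 (Ordinal (jm : (j < m.+1)%N)))//=.
  rewrite coefXn eqxx mul1r big1 ?addr0// => i ij.
  by rewrite coefXn (_ : (i == j :> nat) = false) ?mul0r//; apply/negbTE.
rewrite -[RHS](LX 0%N)// expr0.
have -> : 1 = (('X + 1) - 'X) ^+ m :> {poly A} by rewrite addrC addKr expr1n.
rewrite exprBn Lsum; apply: eq_bigr => k _.
have km : (k <= m)%N by rewrite -ltnS.
rewrite -sum_bitseqs_Xn.
have -> : (-1) ^+ k * (\sum_(b <- bitseqs (m - k)) 'X^(count id b)) * 'X^k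
      *+ 'C(m, k) =
    ((-1) ^+ k * 'C(m, k)%:R) *:
      \sum_(b <- bitseqs (m - k)) 'X^(k + count id b) :> {poly A}.
  rewrite -mul_polyC polyCM polyC_exp polyCN polyC1 polyC_natr -mulr_natr.
  under [in RHS]eq_bigr do rewrite exprD.
  by rewrite -mulr_sumr; ring.
rewrite LZ Lsum; congr (_ * _); rewrite big_seq [RHS]big_seq.
apply: eq_bigr => b /size_bitseqs sb; rewrite LX//.
by rewrite -leq_subRL// -sb count_size.
Qed.

Lemma perm_cat_mask (T : eqType) (b : bitseq) (s : seq T) : size b = size s ->
  perm_eq (mask b s ++ mask (map negb b) s) s.
Proof.
elim: s b => [|x s IHs] [|[] b] //= [sb].
  by rewrite perm_cons IHs.
by rewrite -cat1s perm_catCA/= perm_cons IHs.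
Qed.

(** The permutation comes from partitioning the positions rather than the entries, so it is the same
    for every [I]. *)
Lemma mask_permute n m (b : bitseq) : size b = m ->
  exists s : 'S_m, forall I : m.-tuple 'I_n,
    permute s I = mask b I ++ mask (map negb b) I :> seq 'I_n.
Proof.
move=> sb; have /tuple_permP[s sE] : perm_eq
    (mask b (ord_tuple m) ++ mask (map negb b) (ord_tuple m)) (ord_tuple m).
  by apply: perm_cat_mask; rewrite size_tuple.
exists s => I.
have mI : I = map (tnth I) (ord_tuple m) :> seq 'I_n.
  by rewrite /= map_tnth_enum.
rewrite [in RHS]mI -!(map_mask (tnth I)) -map_cat sE /= -map_comp.
by apply: eq_map => i /=; rewrite tnth_ord_tuple.
Qed.

End Bitseqs.

Section MixedDerivatives.
Context {R : realType} {n m : nat}.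
Context (f : 'rV[R]_n -> symtensor R n m) (hf : schwartz_field f).
Implicit Types (w : seq 'I_n) (p : 'rV[R]_n * 'rV[R]_n).

(* [b] marks the [xi]-derivatives that fall on the coordinates of [f] rather
   than on the powers of [xi]. *)
Let term k w1 w2 b p := (m ^_ (count negb b))%:R *
  contracted_moment f (k + count id b) (w1 ++ mask b w2)
    (mask (map negb b) w2) p.

Lemma size_mask_negb (b : bitseq) w : size b = size w ->
  size (mask (map negb b) w) = count negb b.
Proof. by move=> sb; rewrite size_mask ?size_map// count_map. Qed.

(** The [xi]-derivatives are innermost and treated first; each doubles the terms, while an
    [x]-derivative acts only on the moments. Derivability and formula go together, as the formula is
    what gets differentiated next. *)
Lemma iter_derive_momentum_ray k w1 w2 : (size w2 <= m)%N ->
  let ds := map dir_x w1 ++ map dir_xi w2 in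
  iter_derivable ray_domain ds (momentum_ray k f) /\
  forall p, p.2 != 0 -> iter_derive ds (momentum_ray k f) p =
    \sum_(b <- bitseqs (size w2)) term k w1 w2 b p.
Proof.
move=> sw2 /=; elim: w1 => [|i w1 [IH1 IH2]] /=.
  elim: w2 sw2 => [|i w2 IHw2] /= sw2.
    split=> // p p0; rewrite big_seq1 /term/= ffactn0 mul1r addn0.
    exact: momentum_rayE.
  have [IH1 IH2] := IHw2 (ltnW sw2).
  have D p : p.2 != 0 -> is_cderive p (dir_xi i)
      (iter_derive (map dir_xi w2) (momentum_ray k f))
      (\sum_(b <- bitseqs (size w2).+1) term k [::] (i :: w2) b p).
    move=> p0; apply: (is_cderive_local open_ray_domain p0 IH2).
    rewrite big_bitseqsS; apply: is_cderive_sum => b /size_bitseqs sb.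
    have sm := size_mask_negb sb.
    have cm : (count negb b <= m)%N.
      by rewrite (leq_trans (count_size _ _))// sb ltnW.
    apply: is_cderive_eq.
      apply: is_cderive_nat.
      apply: (@is_cderive_contracted_moment _ _ _ _ hf true).
        by rewrite sm.
      exact: p0.
    rewrite mulrDr /term /=; congr (_ * contracted_moment _ _ _ _ _ + _).
      by rewrite !add1n addnS.
    (* The new factor [m - count negb b] extends the falling factorial by one step. *)
    by rewrite mul1n sm mulrA -natrM -ffactnSr add1n add0n.
  split; first by split=> // p p0; exact: is_cderive_cderivable (D p p0).
  by move=> p p0; exact: is_cderive_val (D p p0).
have D p : p.2 != 0 -> is_cderive p (dir_x i)
    (iter_derive (map dir_x w1 ++ map dir_xi w2) (momentum_ray k f))
    (\sum_(b <- bitseqs (size w2)) term k (i :: w1) w2 b p).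
  move=> p0; apply: (is_cderive_local open_ray_domain p0 IH2).
  apply: is_cderive_sum => b /size_bitseqs sb.
  have sm := size_mask_negb sb.
  apply: is_cderive_eq.
    apply: is_cderive_nat.
      apply: (@is_cderive_contracted_moment _ _ _ _ hf false).
      by rewrite sm (leq_trans (count_size _ _))// sb.
    exact: p0.
  by rewrite mul0n mul0r addr0 add0n.
split; first by split=> // p p0; exact: is_cderive_cderivable (D p p0).
by move=> p p0; exact: is_cderive_val (D p p0).
Qed.

Context (I : m.-tuple 'I_n).

Lemma size_drop_permute k (s : 'S_m) : size (drop k (permute s I)) = (m - k)%N.
Proof. by rewrite size_drop size_tuple. Qed.

Lemma permuteM (s t : 'S_m) : permute s (permute t I) = permute (s * t)%g I.
Proof. by apply: eq_from_tnth => k; rewrite !tnth_mktuple permM. Qed.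

(* The permutation that lists the positions selected by [b] first, in
   increasing order, is absorbed by the sum over all [s]. *)
Lemma sum_permute_mask (A : nmodType) (F : seq 'I_n -> seq 'I_n -> A) b :
  size b = m ->
  \sum_(s : 'S_m) F (mask b (permute s I)) (mask (map negb b) (permute s I)) =
  \sum_(s : 'S_m) F (take (count id b) (permute s I))
                    (drop (count id b) (permute s I)).
Proof.
move=> sb; have [t tE] := mask_permute n sb.
rewrite [RHS](reindex_inj (mulgI t)); apply: eq_bigr => s _.
rewrite -permuteM tE.
have sz : size (mask b (permute s I)) = count id b.
  by rewrite size_mask// size_tuple.
by rewrite take_size_cat// drop_size_cat.
Qed.

(** The [k] derivatives in [x] match the initial order [k] of [J^k], so the moment order always
    equals the number of derivatives on the moments. After summation over [s], only this number
    matters. *)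
Lemma sum_iter_derive_mixed k p : (k <= m)%N -> p.2 != 0 ->
  \sum_(s : 'S_m)
    iter_derive (mixed_dirs k (permute s I)) (momentum_ray k f) p =
  \sum_(b <- bitseqs (m - k)) (m ^_ (m - (k + count id b)))%:R *
    \sum_(s : 'S_m) contracted_moment f (k + count id b)
      (take (k + count id b) (permute s I))
      (drop (k + count id b) (permute s I)) p.
Proof.
move=> km p0.
under eq_bigr => s _.
  have [|_ ->//] := @iter_derive_momentum_ray k (take k (permute s I))
    (drop k (permute s I)).
    by rewrite size_drop_permute leq_subr.
  rewrite size_drop_permute; over.
rewrite exchange_big/= big_seq [RHS]big_seq.
apply: eq_bigr => b /size_bitseqs sb.
(* The [x]-derivatives act on the moments, hence the prefix of [k] bits [true]. *)
pose b' := nseq k true ++ b.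
have sb' : size b' = m by rewrite size_cat size_nseq sb subnKC.
have cb' : count id b' = (k + count id b)%N.
  by rewrite count_cat count_nseq mul1n.
rewrite -cb'.
rewrite -(sum_permute_mask
  (fun w c => contracted_moment f (count id b') w c p) sb').
rewrite mulr_sumr; apply: eq_bigr => s _.
rewrite /term -cb'; cbv beta; congr (_ * _).
  congr (_%:R); congr (m ^_ _).
  rewrite -[X in (X - _)%N]sb' -(count_predC id b') addKn.
  by rewrite count_cat count_nseq/= mul0n.
congr contracted_moment.
- rewrite -[in RHS](cat_take_drop k (permute s I)) mask_cat ?mask_true//.
    by rewrite size_takel// size_tuple.
  by rewrite size_nseq size_takel// size_tuple.
- rewrite -[in RHS](cat_take_drop k (permute s I)) map_cat map_nseq mask_cat.
    by rewrite mask_false.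
  by rewrite size_nseq size_takel// size_tuple.
Qed.

End MixedDerivatives.

Lemma ray_scalar_tensor (R : realType) n (g : 'rV[R]_n -> R[i]) p :
  ray (fun y => scalar_tensor (g y)) p = cray_moment 0 g p.
Proof.
apply: eq_cintegral => t; congr (_ * _); rewrite /pairing.
rewrite (big_pred1 [tuple]) => [|K]; last by apply/esym/eqP; exact: tuple0.
by rewrite big_ord0 mulr1.
Qed.

Lemma contracted_moment_full (R : realType) n m
    (f : 'rV[R]_n -> symtensor R n m) k w (I : m.-tuple 'I_n) p :
  contracted_moment f k w I p =
  cray_moment k (partials w (fun x => f x I)) p.
Proof.
by rewrite /contracted_moment size_tuple subnn /= cats0 seq_coordinateE.
Qed.

(** The first conjunct ensures that the derivatives in the formula exist, so that no default value
    of a limit enters it. *)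
Theorem theorem3p1 (R : realType) (n m : nat) (hn : (2 <= n)%N)
    (f : 'rV[R]_n -> symtensor R n m) (hf : schwartz_field f)
    (I : m.-tuple 'I_n) :
  (forall (k : nat) (s : 'S_m), (k <= m)%N ->
     iter_derivable ray_domain (mixed_dirs k (permute s I))
       (momentum_ray k f)) /\
  (forall x xi : 'rV[R]_n, xi != 0 ->
     ray (fun y => scalar_tensor (f y I)) (x, xi) =
     (m`!%:R)^-1 *
     symmetrize (fun K : m.-tuple 'I_n =>
       \sum_(k < m.+1) (-1) ^+ k * 'C(m, k)%:R *
         iter_derive (mixed_dirs k K) (momentum_ray k f) (x, xi)) I).
Proof.
split=> [k s km|x xi xi0].
  have [|+ _] := @iter_derive_momentum_ray _ _ _ _ hf k (take k (permute s I))
    (drop k (permute s I)); last exact.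
  by rewrite size_drop_permute leq_subr.
rewrite ray_scalar_tensor /symmetrize exchange_big/=.
(* [phi j] is the sum over all permutations of the products with [j] factors [b] and [m - j] factors
   [a]; the alternating sum leaves [phi 0], that is, [a^m]. *)
pose phi j := (m ^_ (m - j))%:R * \sum_(s : 'S_m) contracted_moment f j
  (take j (permute s I)) (drop j (permute s I)) (x, xi).
have -> : \sum_(k < m.+1) \sum_(s : 'S_m) (-1) ^+ k * 'C(m, k)%:R *
      iter_derive (mixed_dirs k (permute s I)) (momentum_ray k f) (x, xi) =
    phi 0%N.
  rewrite -[RHS](@alternating_bitseqs_sum _ m phi); apply: eq_bigr => k _.
  by rewrite -mulr_sumr sum_iter_derive_mixed// -ltnS.
have fact0 : m`!%:R != 0 :> R[i] by rewrite pnatr_eq0 -lt0n fact_gt0.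
(* One factor [1 / m!] cancels [m ^_ m]; the other averages over the [m!] permutations, whose terms
   are all equal. *)
rewrite /phi subn0 ffactnn mulKf//.
rewrite (eq_bigr (fun=> cray_moment 0 (fun y => f y I) (x, xi))) => [|s _].
  rewrite sumr_const card_Sn -[X in _ * X]mulr_natl mulKf//.
(* All [m] indices are fixed and no power of [xi] remains; the symmetry of [f] removes [s]. *)
rewrite take0 drop0 contracted_moment_full; congr cray_moment.
apply/funext => y; rewrite /partials/=; case: (f y) => u usym /=.
exact: usym.
Qed.
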